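(* Let $D_n=\{f^i r^j \mid o(f)=2,\ o(r)=n,\ rf=fr^{-1}\}$ be the finite non-abelian (dihedral) group with $2n$ elements, and let $x\in D_n$. Then: (i) If $o(x)\ne 2$ (so that $x\in\langle r\rangle$), then the degree of $x$ in the Co-Prime Order graph $\Theta(D_n)$ minus the degree of $x$ in the Co-Prime Order graph $\Theta(\langle r\rangle)$ equals $n$. (ii) If $o(x)=2$, then the degree of $x$ in $\Theta(D_n)$ is $2n-1$.
   Context: For a finite group $G$, $o(x)$ denotes the order of $x\in G$. The Co-Prime Order graph $\Theta(G)$ is the simple undirected graph with vertex set $G$ in which two distinct vertices $x,y$ are adjacent if and only if $\gcd(o(x),o(y))$ is $1$ or a prime. $\langle r\rangle$ is the cyclic subgroup of $D_n$ of order $n$ generated by $r$, and $\Theta(\langle r\rangle)$ is the Co-Prime Order graph of this group. *)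

(* Defs.v *)
From mathcomp Require Import all_boot all_fingroup all_algebra.

Set Implicit Arguments.
Unset Strict Implicit.
Unset Printing Implicit Defensive.

Import GroupScope.

(* The ambient type T may be larger than the vertex set; [sg_adjV] then keeps
   edges inside the vertex set. *)
Record sgraph (T : finType) := SGraph {
  sg_vertices : {set T};
  sg_adj : rel T;
  sg_adjV : forall x y, sg_adj x y -> (x \in sg_vertices) && (y \in sg_vertices);
  sg_sym : symmetric sg_adj;
  sg_irr : irreflexive sg_adj
}.

Definition degree (T : finType) (X : sgraph T) (x : T) : nat :=
  #|[set y in sg_vertices X | sg_adj X x y]|.

Section CoprimeOrderGraph.
Variables (gT : finGroupType) (G : {group gT}).

Definition coprime_order_adj : rel gT := fun x y =>
  [&& x \in G, y \in G, x != y &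
      (gcdn #[x] #[y] == 1%N) || prime (gcdn #[x] #[y])].

Lemma coprime_order_adjV x y :
  coprime_order_adj x y -> (x \in G) && (y \in G).
Proof. by case/and4P=> -> ->. Qed.

Lemma coprime_order_sym : symmetric coprime_order_adj.
Proof.
by move=> x y; rewrite /coprime_order_adj andbCA [x == y]eq_sym gcdnC.
Qed.

Lemma coprime_order_irr : irreflexive coprime_order_adj.
Proof. by move=> x; rewrite /coprime_order_adj eqxx !andbF. Qed.

Definition coprime_order_graph : sgraph gT :=
  SGraph coprime_order_adjV coprime_order_sym coprime_order_irr.

End CoprimeOrderGraph.

(* D = {f^i r^j | o(f) = 2, o(r) = n, r f = f r^-1}, non-abelian of order 2n
   (so n >= 3).  Keeping f and r explicit fixes the rotation subgroup <[r]>. *)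
Definition dihedral_with (gT : finGroupType) (D : {group gT}) (n : nat)
    (f r : gT) : Prop :=
  [/\ [/\ #[f] = 2, #[r] = n & r * f = f * r^-1],
      forall z, z \in D <-> exists i j : nat, z = f ^+ i * r ^+ j,
      #|D| = (2 * n)%N
    & ~~ abelian D].

(* Main.v *)
Require Import Defs.
From mathcomp Require Import all_boot all_fingroup all_algebra.
From mathcomp Require Import cyclic.

Set Implicit Arguments.
Unset Strict Implicit.
Unset Printing Implicit Defensive.

Import GroupScope.

(** An involution is adjacent to every other vertex of a co-prime order graph,
    because the gcd of 2 with another order divides 2, and so is 1 or the
    prime 2 ([involution_adj]).  This gives the degree [2n - 1] of an
    involution at once.

    In a dihedral group every element outside the rotation subgroup [<[r]>] is
    a reflection [f * r ^+ j], hence an involution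
    ([dihedral_reflection_order]).  So an [x] that is not an involution is a
    rotation, and passing from [<[r]>] to the whole group keeps its old
    neighbours and adds all [2n - n = n] reflections
    ([degree_involution_extension]). *)

Section CoprimeOrderDegree.
Variables (gT : finGroupType) (G : {group gT}).

(** The gcd of 2 with any order is 1 or 2, so only membership and
    distinctness remain to be checked. *)
Lemma involution_adj (x y : gT) : #[x] = 2 ->
  coprime_order_adj G x y = [&& x \in G, y \in G & x != y].
Proof.
move=> ox; rewrite /coprime_order_adj ox.
suff ->: (gcdn 2 #[y] == 1%N) || prime (gcdn 2 #[y]) by rewrite andbT.
have := dvdn_gcdl 2 #[y]; rewrite dvdn_divisors //.
by rewrite !inE => /orP[] /eqP->.
Qed.

Lemma degree_involution (x : gT) : x \in G -> #[x] = 2 ->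
  degree (coprime_order_graph G) x = #|G|.-1.
Proof.
move=> xG ox; rewrite /degree /= (cardsD1 x G) xG /=.
apply: eq_card => y; rewrite !inE involution_adj // xG /= [y == x]eq_sym.
by case: (y \in G); rewrite ?andbT ?andbF.
Qed.

(** Adjacency depends only on the two orders, so the graph of [H] is the
    subgraph of the graph of [G] induced on [H]; the vertices of [G :\: H],
    being involutions, are then all new neighbours of [x]. *)
Lemma degree_involution_extension (H : {group gT}) (x : gT) :
    H \subset G -> {in G :\: H, forall y, #[y] = 2} -> x \in H ->
  degree (coprime_order_graph G) x
    = (degree (coprime_order_graph H) x + #|G :\: H|)%N.
Proof.
move=> sHG invGH xH; have xG := subsetP sHG x xH.
rewrite /degree -[LHS](cardsID H); congr (_ + _)%N; apply: eq_card => y.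
  rewrite !inE /= /coprime_order_adj xG xH /=.
  by case yH: (y \in H); rewrite ?andbF // (subsetP sHG) ?andbT.
rewrite !inE /=; case yH: (y \in H) => //=.
case yG: (y \in G) => //=.
have oy: #[y] = 2 by apply: invGH; rewrite inE yH yG.
rewrite coprime_order_sym involution_adj // yG xG /=.
by apply: contraFneq yH => ->.
Qed.

End CoprimeOrderDegree.

(** Conjugation by [f] inverts every power of [r], so [r ^+ j] cancels in the
    square of [f * r ^+ j]. *)
Lemma reflection_sqr (gT : finGroupType) (f r : gT) (j : nat) :
  #[f] = 2 -> r * f = f * r^-1 -> (f * r ^+ j) ^+ 2 = 1.
Proof.
move=> of2 rf; have rJf: r ^ f = r^-1 by rewrite conjgE rf mulKg.
rewrite expgS expg1 mulgA -(mulgA f) (conjgC (r ^+ j)) conjXg rJf mulgA.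
by rewrite expgVn mulgKV -expg2 -of2 expg_order.
Qed.

Lemma dihedral_rotations_sub (gT : finGroupType) (D : {group gT}) (n : nat)
  (f r : gT) : dihedral_with D n f r -> <[r]> \subset D.
Proof.
case=> _ memD _ _; rewrite cycle_subG; apply/memD.
by exists 0, 1%N; rewrite mul1g.
Qed.

Lemma dihedral_reflection_order (gT : finGroupType) (D : {group gT}) (n : nat)
  (f r : gT) : dihedral_with D n f r -> {in D :\: <[r]>, forall z, #[z] = 2}.
Proof.
case=> -[of2 _ rf] memD _ _ z /setDP[/memD[i [j ->]]].
(* Since f ^+ 2 = 1, only the parity of i matters. *)
rewrite -(expg_mod_order f) of2 modn2.
case: (odd i) => [|/negP[]]; last by rewrite mul1g mem_cycle.
rewrite expg1 => notr; apply: nt_prime_order => //.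
  exact: reflection_sqr.
by apply: contraNneq notr => ->; exact: group1.
Qed.

Theorem corollary1 (gT : finGroupType) (D : {group gT}) (n : nat) (f r : gT)
  (hD : dihedral_with D n f r) (x : gT) (hx : x \in D) :
  (#[x] <> 2 ->
     x \in <[r]> /\
     ((degree (coprime_order_graph D) x)%:Z
        - (degree (coprime_order_graph <[r]>) x)%:Z = n%:Z)%R) /\
  (#[x] = 2 -> degree (coprime_order_graph D) x = (2 * n - 1)%N).
Proof.
have srD := dihedral_rotations_sub hD.
have refl2 := dihedral_reflection_order hD.
have [[_ or _] _ cardD _] := hD.
split=> ox; last by rewrite degree_involution // cardD subn1.
have xr: x \in <[r]>.
  by case: (boolP (x \in <[r]>)) => // xr; case: ox; rewrite refl2 // inE xr.
split=> //; rewrite (degree_involution_extension srD refl2 xr).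
rewrite cardsD (setIidPr srD) -orderE or cardD mul2n -addnn addnK.
by rewrite PoszD GRing.addrC GRing.addKr.
Qed.
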